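(* Let $(B_{oole},\cap,\cup,\sim,\bot,\top)$ be a Boolean algebra. Then there exist a Boolean algebra $(B_{ayes},\cap,\cup,\sim,\bot,\top)$ and a binary operator $[\;]:B_{ayes}\times B_{ayes}\to B_{ayes}$, $(x,y)\mapsto [x]y$, such that: (1) there is an injective Boolean morphism $\delta:B_{oole}\to B_{ayes}$; (2) for all $x,y\in B_{ayes}$: the map $z\mapsto [x]z$ is a Boolean automorphism of $B_{ayes}$; if $x\subset y$ then $[x]y=\top$ or $x=\bot$; $x\cap [x]y=x\cap y$; and $[\sim x][x]y=[x][x]y=[x]y$; (3) for every probability distribution $P_{oole}$ on $B_{oole}$ there is a probability distribution $P_{ayes}$ on $B_{ayes}$ such that $P_{ayes}\circ\delta=P_{oole}$ and $P_{ayes}(x\cap y)=P_{ayes}([x]y)\,P_{ayes}(x)$ for all $x,y\in B_{ayes}$.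
   Context: A Boolean morphism $\delta$ satisfies $\delta(\sim x)=\sim\delta(x)$ and $\delta(x\cap y)=\delta(x)\cap\delta(y)$. $x\subset y$ denotes the order of the Boolean algebra ($x\cap y=x$). A probability distribution on a Boolean algebra $E$ is a map $P:E\to\mathbb{R}$ with $P\ge 0$, $P(\bot)=0$, $P(\top)=1$ and $P(x\cap y)+P(x\cup y)=P(x)+P(y)$ for all $x,y\in E$ (finite additivity only).
   Formalization: ''Boolean automorphism'' is read as a Boolean morphism of B_ayes into itself, not necessarily bijective: [x]x = ⊤ = [x]⊤ for x ≠ ⊥, so bijectivity would force B_ayes to have only ⊥ and ⊤, and no larger B_oole could embed. *)

(* Defs.v *)
From HB Require Import structures.
From mathcomp Require Import all_boot all_order all_algebra.
From mathcomp Require Import reals.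
Set Implicit Arguments.
Unset Strict Implicit.
Unset Printing Implicit Defensive.
Import Order.Theory GRing.Theory Num.Theory.
Local Open Scope order_scope.

(* A Boolean algebra is a [ctbDistrLatticeType]; the one-element algebra, in
   which \bot = \top, is allowed.  Preservation of joins, \bot and \top follows
   from the two clauses below. *)
Definition boolean_morphism (d1 d2 : Order.disp_t)
    (A : ctbDistrLatticeType d1) (B : ctbDistrLatticeType d2)
    (f : A -> B) : Prop :=
  (forall x : A, f (~` x) = ~` f x) /\
  (forall x y : A, f (x `&` y) = f x `&` f y).

(* The maps z |-> [x]z of a Bayesian algebra are "automorphisms" only in the
   sense of morphisms from the algebra to itself: [x]x = \top = [x]\top for
   every x <> \bot, so bijectivity would leave no elements but \bot and \top. *)
Definition boolean_endomorphism (d : Order.disp_t)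
    (A : ctbDistrLatticeType d) (f : A -> A) : Prop :=
  boolean_morphism f.

Definition probability_distribution (R : realType) (d : Order.disp_t)
    (E : ctbDistrLatticeType d) (P : E -> R) : Prop :=
  [/\ forall x : E, (0 <= P x)%R,
      P \bot = 0%R,
      P \top = 1%R &
      forall x y : E, (P (x `&` y) + P (x `|` y) = P x + P y)%R].

(* Main.v *)
(** A Hilbert hotel argument.  By Stone's theorem Boole is an algebra of sets;
    call "space" any algebra of subsets of a fixed set [V], together with one
    law for each probability distribution on Boole.  Bayes is the algebra of
    cylinders of the product of all spaces, each one repeated countably often,
    and [P_ayes] is the product measure.  A nonempty cylinder [x] depends on
    finitely many coordinates; packed into a single point of [V], with the
    conditional law given [x], they form again one of the spaces.  Replacing
    these coordinates by one new copy of that space and shifting the others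
    yields an isomorphism from [x] onto the whole product which scales each
    measure by [P x].  For [x] and [~ x] both nonempty this gives an
    isomorphism between [x] and [~ x], hence an involution swapping them that
    preserves relative measures, and [x]y is the set that agrees with y on [x]
    and with the transported part of y on [~ x]. *)

Require Import Defs.
From HB Require Import structures.
From mathcomp Require Import all_boot all_order all_algebra.
From mathcomp Require Import reals.
From mathcomp Require Import boolp classical_sets.
Set Implicit Arguments.
Unset Strict Implicit.
Unset Printing Implicit Defensive.
Import Order.Theory GRing.Theory Num.Theory.
Local Open Scope order_scope.

(** * Algebras of subsets and finitely additive probabilities *)

Section SetAlgebra.
Variables (R : realType) (T : Type).
Local Open Scope ring_scope.

Definition set_algebra (A : (T -> bool) -> Prop) : Prop :=
  [/\ A xpredT, forall a, A a -> A (fun t => ~~ a t) &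
      forall a b, A a -> A b -> A (fun t => a t && b t)].

(** Additivity takes the form of splitting [a] along [b], which is what the inductions below use. *)
Definition set_prob (A : (T -> bool) -> Prop) (Q : (T -> bool) -> R) : Prop :=
  [/\ Q xpredT = 1, forall a, A a -> 0 <= Q a &
      forall a b, A a -> A b ->
        Q a = Q (fun t => a t && b t) + Q (fun t => a t && ~~ b t)].

Variables (A : (T -> bool) -> Prop) (Q : (T -> bool) -> R).
Hypotheses (algA : set_algebra A) (probQ : set_prob A Q).

Lemma set_prob0 : Q xpred0 = 0.
Proof.
case: algA probQ => AT AN AI [_ _ /(_ xpred0 xpred0)] H.
have A0 : A xpred0 by exact: AN _ AT.
by apply: (addrI (Q xpred0)); rewrite addr0; exact/esym/H.
Qed.

Lemma set_prob_le a b : A a -> A b -> (forall t, a t -> b t) -> Q a <= Q b.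
Proof.
case: algA probQ => AT AN AI [_ Q0 QD] Aa Ab ab.
rewrite (QD b a) // (_ : (fun t => b t && a t) = a).
  by rewrite lerDl; apply/Q0/AI/AN.
by apply/funext => t; apply/andb_idl/ab.
Qed.

(** Positivity of the integral of a simple function over [c]. Induction on [s]: splitting [c] along
    [a j] makes the indicator of [a j] constant on each piece, where it is absorbed into [k]. *)
Lemma set_prob_sum_ge0 (J : Type) (s : seq J) (r : J -> R)
    (a : J -> T -> bool) (c : T -> bool) (k : R) :
    (forall j, A (a j)) -> A c ->
    (forall t, c t -> 0 <= k + \sum_(j <- s) r j * (a j t)%:R) ->
  0 <= k * Q c + \sum_(j <- s) r j * Q (fun t => c t && a j t).
Proof.
case: algA probQ => AT AN AI [_ Q0 QD] Aa.
elim: s c k => [|j s IH] c k Ac H.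
  rewrite big_nil addr0.
  (* Either [c] is empty and has mass 0, or one of its points shows that [k] is nonnegative. *)
  have [c0|/existsNP[t /negP]] := pselect (forall t, ~~ c t).
    rewrite (_ : c = xpred0) ?set_prob0 ?mulr0 //.
    by apply/funext => t; apply/negbTE.
  rewrite negbK => /H; rewrite big_nil addr0 => k0.
  by rewrite mulr_ge0 ?Q0.
have IH1 := IH (fun t => c t && a j t) (k + r j) (AI _ _ Ac (Aa j)).
have IH2 := IH (fun t => c t && ~~ a j t) k (AI _ _ Ac (AN _ (Aa j))).
have -> : k * Q c + \sum_(i <- j :: s) r i * Q (fun t => c t && a i t) =
   ((k + r j) * Q (fun t => c t && a j t) +
     \sum_(i <- s) r i * Q (fun t => (c t && a j t) && a i t)) +
   (k * Q (fun t => c t && ~~ a j t) +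
     \sum_(i <- s) r i * Q (fun t => (c t && ~~ a j t) && a i t)).
  rewrite big_cons (QD c (a j)) // mulrDr mulrDl -!addrA; congr (_ + _).
  rewrite [LHS]addrCA; congr (_ + _); rewrite [RHS]addrCA; congr (_ + _).
  rewrite -big_split /=; apply: eq_bigr => i _; rewrite -mulrDr; congr (_ * _).
  rewrite (QD _ (a j)) //; last exact: AI.
  by congr (Q _ + Q _); apply/funext => t; exact: andbAC.
rewrite addr_ge0 //.
- apply: IH1 => t /andP[ct ajt]; have := H t ct.
  by rewrite big_cons ajt mulr1 addrA.
- apply: IH2 => t /andP[ct /negbTE ajt]; have := H t ct.
  by rewrite big_cons ajt mulr0 add0r.
Qed.

End SetAlgebra.

(** * The product of all spaces and its cylinders *)

Section ProductMeasure.
Variables (R : realType) (I V : Type) (v0 : V).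
Local Open Scope ring_scope.

Record space := Space {
  meas : (V -> bool) -> Prop;
  law : I -> (V -> bool) -> R;
  space_algebra : set_algebra meas;
  space_prob : forall i, set_prob meas (law i) }.

HB.instance Definition _ := gen_eqMixin space.

Definition coord := (space * nat)%type.
HB.instance Definition _ := Equality.on coord.
Definition point := coord -> V.

(** [D] bounds the coordinates that may be consulted. The inductive form lets most properties be
    checked on generators. *)
Inductive cyl (D : coord -> Prop) : (point -> bool) -> Prop :=
| cyl_gen w a : D w -> meas w.1 a -> cyl D (fun u => a (u w))
| cylT : cyl D xpredT
| cylN z : cyl D z -> cyl D (fun u => ~~ z u)
| cylI y z : cyl D y -> cyl D z -> cyl D (fun u => y u && z u).

Definition cylinder := cyl (fun=> True).

Lemma cyl_algebra D : set_algebra (cyl D).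
Proof. by split; [exact: cylT | exact: cylN | exact: cylI]. Qed.

Lemma cylU D y z : cyl D y -> cyl D z -> cyl D (fun u => y u || z u).
Proof.
move=> /cylN Dy /cylN Dz; have := cylN (cylI Dy Dz).
by congr (cyl D _); apply/funext => u; rewrite negb_and !negbK.
Qed.

Lemma cyl_cst D b : cyl D (fun=> b).
Proof. by case: b; [exact: cylT | exact: (cylN (cylT D))]. Qed.

Lemma cyl_sub (D D' : coord -> Prop) z :
  (forall w, D w -> D' w) -> cyl D z -> cyl D' z.
Proof.
move=> DD'; elim => [w a /DD' Dw wa||y _|y y' _ + _].
- exact: cyl_gen.
- exact: cylT.
- exact: cylN.
- exact: cylI.
Qed.

Lemma cyl_subst D D' (f : point -> point) z :
    (forall w a, D w -> meas w.1 a -> cyl D' (fun u => a (f u w))) ->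
  cyl D z -> cyl D' (fun u => z (f u)).
Proof.
move=> H; elim => [w a Dw wa||y _|y y' _ + _].
- exact: H.
- exact: cylT.
- exact: cylN.
- exact: cylI.
Qed.

(** Agreement is asked only as far as measurable sets can tell, since distinct points of [V] may be
    inseparable in a given space; [shrinkK] relies on this. *)
Lemma cyl_eq D z u u' :
    (forall w a, D w -> meas w.1 a -> a (u w) = a (u' w)) ->
  cyl D z -> z u = z u'.
Proof. by move=> H; elim => [w a /H||y _ ->|y y' _ -> _ ->] //; apply. Qed.

Lemma cyl_fin D z : cyl D z ->
  exists F : seq coord, (forall w, w \in F -> D w) /\ cyl (fun w => w \in F) z.
Proof.
elim => [w a Dw wa||y _ [F [DF Fy]]|y y' _ [F [DF Fy]] _ [F' [DF' Fy']]].
- exists [:: w]; split; first by move=> w'; rewrite inE => /eqP ->.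
  by apply: cyl_gen => //; rewrite inE.
- by exists [::]; split => //; exact: cylT.
- by exists F; split => //; exact: cylN.
- exists (F ++ F'); split=> [w|]; first by rewrite mem_cat => /orP[/DF|/DF'].
  by apply: cylI; [move: Fy|move: Fy']; apply: cyl_sub => w;
    rewrite mem_cat => ->; rewrite ?orbT.
Qed.

(** * Simple functions on finitely many coordinates and their integrals *)

Definition monomial (L : seq coord) (a : coord -> V -> bool) (u : point) : R :=
  \prod_(w <- L) (a w (u w))%:R.
(** For duplicate-free [L], the product mass of the box whose indicator is [monomial L a]. *)
Definition weight i (L : seq coord) (a : coord -> V -> bool) : R :=
  \prod_(w <- L) law w.1 i (a w).
Definition measurable_family (a : coord -> V -> bool) :=
  forall w, meas w.1 (a w).

Lemma meas_cst (c : space) b : meas c (fun=> b).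
Proof.
by case: (space_algebra c) => cT cN _; case: b => //; exact: (cN _ cT).
Qed.

Lemma measI (c : space) a b : meas c a -> meas c b -> meas c (fun t => a t && b t).
Proof. by case: (space_algebra c) => _ _; apply. Qed.

Lemma lawT (c : space) i : law c i xpredT = 1.
Proof. by case: (space_prob c i). Qed.

(* Induction on [L], integrating out one coordinate at a time.  This positivity
   makes [rep] below functional, so that no canonical form of a cylinder is
   needed to define its measure. *)
Lemma weight_ge0 i L (J : finType) (r : J -> R) (a : J -> coord -> V -> bool) :
    uniq L -> (forall j, measurable_family (a j)) ->
    (forall u, 0 <= \sum_j r j * monomial L (a j) u) ->
  0 <= \sum_j r j * weight i L (a j).
Proof.
move=> + ma; elim: L r => [|w L IH] r.
  move=> _ /(_ (fun=> v0)); congr (0 <= _).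
  by apply: eq_bigr => j _; rewrite /monomial /weight !big_nil.
move=> /= /andP[wL uL] H.
have -> : \sum_j r j * weight i (w :: L) (a j) =
          \sum_j (r j * law w.1 i (a j w)) * weight i L (a j).
  by apply: eq_bigr => j _; rewrite /weight big_cons mulrA.
apply: IH => // u.
have := @set_prob_sum_ge0 R V (meas w.1) (law w.1 i) (space_algebra _)
  (space_prob _ _) J (index_enum J) (fun j => r j * monomial L (a j) u)
  (fun j => a j w) xpredT 0 (fun j => ma j w) (meas_cst w.1 true).
rewrite mul0r add0r => H'.
rewrite (eq_bigr _ (fun j _ => mulrAC _ _ _)); apply: H' => t _.
rewrite add0r.
have := H (fun w' => if w' == w then t else u w').
congr (0 <= _); apply: eq_bigr => j _.
rewrite /monomial big_cons eqxx -mulrA [X in _ = _ * X]mulrC.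
congr (_ * (_ * _)); apply: eq_big_seq => w' w'L.
by case: eqP w'L wL => // -> ->.
Qed.

(** A simple function with the integral computed from one of its decompositions into boxes. It is a
    relation because decompositions are not unique. *)
Definition rep i (L : seq coord) (f : point -> R) (e : R) : Prop :=
  exists (J : finType) (r : J -> R) (a : J -> coord -> V -> bool),
    [/\ forall j, measurable_family (a j),
        forall u, f u = \sum_j r j * monomial L (a j) u &
        e = \sum_j r j * weight i L (a j)].

Lemma rep_ge0 i L f e : uniq L -> rep i L f e -> (forall u, 0 <= f u) -> 0 <= e.
Proof.
move=> uL [J [r [a [ma fE ->]]]] f0; apply: weight_ge0 => // u; by rewrite -fE.
Qed.

Lemma rep_monomial i L a : measurable_family a ->
  rep i L (monomial L a) (weight i L a).
Proof.
move=> ma; exists unit, (fun=> 1), (fun=> a).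
by split=> // [u|]; rewrite big_const card_unit /= mul1r addr0.
Qed.

Lemma rep1 i L : rep i L (fun=> 1) 1.
Proof.
have := @rep_monomial i L (fun _ _ => true) (fun w => meas_cst w.1 true).
rewrite /weight big1 => [|w _]; last exact: lawT.
by congr rep; apply/funext => u; rewrite /monomial big1.
Qed.

Lemma rep_add i L f g e e' : rep i L f e -> rep i L g e' ->
  rep i L (fun u => f u + g u) (e + e').
Proof.
move=> [J [r [a [ma fE ->]]]] [J' [r' [a' [ma' gE ->]]]].
exists (J + J')%type, (fun j => match j with inl j => r j | inr j => r' j end),
  (fun j => match j with inl j => a j | inr j => a' j end).
by split=> [[]//|u|]; rewrite big_sumType ?fE ?gE.
Qed.

Lemma rep_scale i L k f e : rep i L f e -> rep i L (fun u => k * f u) (k * e).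
Proof.
move=> [J [r [a [ma fE ->]]]]; exists J, (fun j => k * r j), a.
by split=> // [u|]; rewrite ?fE mulr_sumr; apply: eq_bigr => j _; rewrite mulrA.
Qed.

Lemma rep_sub i L f g e e' : rep i L f e -> rep i L g e' ->
  rep i L (fun u => f u - g u) (e - e').
Proof.
move=> fe /(rep_scale (-1)) ge; have := rep_add fe ge.
by rewrite mulN1r; congr rep; apply/funext => u; rewrite mulN1r.
Qed.

Lemma rep_le i L f g e e' : uniq L -> rep i L f e -> rep i L g e' ->
  (forall u, f u <= g u) -> e <= e'.
Proof.
move=> uL fe ge fg; rewrite -subr_ge0.
by apply: (rep_ge0 uL (rep_sub ge fe)) => u; rewrite subr_ge0.
Qed.

Lemma rep_sum i L (J : finType) (r : J -> R) (f : J -> point -> R) (e : J -> R) :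
  (forall j, rep i L (f j) (e j)) ->
  rep i L (fun u => \sum_j r j * f j u) (\sum_j r j * e j).
Proof.
move=> H; elim: (index_enum J) => [|j s IH].
  have := rep_scale 0 (rep1 i L); rewrite mul0r big_nil.
  by congr rep; apply/funext => u; rewrite big_nil.
have := rep_add (rep_scale (r j) (H j)) IH; rewrite big_cons.
by congr rep; apply/funext => u; rewrite big_cons.
Qed.

(** Boxes intersect side by side. The integral stays existential: for factors that share coordinates
    it is not determined by [e] and [e']. *)
Lemma rep_mul i L f g e e' : rep i L f e -> rep i L g e' ->
  exists e'', rep i L (fun u => f u * g u) e''.
Proof.
move=> [J [r [a [ma fE _]]]] [J' [r' [a' [ma' gE _]]]].
exists (\sum_(j : J * J') r j.1 * r' j.2 *
  weight i L (fun w v => a j.1 w v && a' j.2 w v)).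
exists (J * J')%type, (fun j => r j.1 * r' j.2),
  (fun j w v => a j.1 w v && a' j.2 w v).
split=> [j w|u|] //=; first by apply: measI; [exact: ma | exact: ma'].
rewrite fE gE big_distrlr /= pair_bigA; apply: eq_bigr => -[j j'] _ /=.
rewrite mulrACA; congr (_ * _); rewrite /monomial -big_split /=.
by apply: eq_bigr => w _; rewrite -natrM mulnb.
Qed.

Lemma big_widen (L L' : seq coord) (g : coord -> R) :
    uniq L -> uniq L' -> {subset L <= L'} ->
  \prod_(w <- L') (if w \in L then g w else 1) = \prod_(w <- L) g w.
Proof.
move=> uL uL' LL'; rewrite -big_mkcond -big_filter; apply: perm_big.
apply: uniq_perm; rewrite ?filter_uniq // => w; rewrite mem_filter.
by apply/andb_idr/LL'.
Qed.

(** Each added coordinate gets the full side, of mass 1. *)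
Lemma rep_widen i L L' f e : uniq L -> uniq L' -> {subset L <= L'} ->
  rep i L f e -> rep i L' f e.
Proof.
move=> uL uL' LL' [J [r [a [ma fE ->]]]].
exists J, r, (fun j w => if w \in L then a j w else xpredT); split=> [j w|u|].
- by case: ifP => _; [exact: ma | exact: (meas_cst w.1 true)].
- rewrite fE; apply: eq_bigr => j _; congr (_ * _).
  rewrite /monomial -(big_widen _ uL uL' LL'); apply: eq_bigr => w _.
  by case: ifP.
- apply: eq_bigr => j _; congr (_ * _).
  rewrite /weight -(big_widen _ uL uL' LL'); apply: eq_bigr => w _.
  by case: ifP => // _; rewrite lawT.
Qed.

(** Independence of disjoint blocks: a box over [L] and a box over [L'] form a box over [L ++ L'],
    and the masses multiply. *)
Lemma rep_indep i L L' f g e e' :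
    uniq L -> uniq L' -> (forall w, w \in L -> w \notin L') ->
    rep i L f e -> rep i L' g e' ->
  rep i (L ++ L') (fun u => f u * g u) (e * e').
Proof.
move=> uL uL' LL' [J [r [a [ma fE ->]]]] [J' [r' [a' [ma' gE ->]]]].
exists (J * J')%type, (fun j => r j.1 * r' j.2),
  (fun j w => if w \in L then a j.1 w else a' j.2 w); split=> [j w|u|].
- by case: ifP => _; [exact: ma | exact: ma'].
- rewrite fE gE big_distrlr /= pair_bigA; apply: eq_bigr => -[j j'] _ /=.
  rewrite mulrACA; congr (_ * _); rewrite /monomial big_cat; congr (_ * _).
    by apply: eq_big_seq => w ->.
  by apply: eq_big_seq => w; case: ifP => // /LL' /negP.
- rewrite big_distrlr /= pair_bigA; apply: eq_bigr => -[j j'] _ /=.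
  rewrite mulrACA; congr (_ * _); rewrite /weight big_cat; congr (_ * _).
    by apply: eq_big_seq => w ->.
  by apply: eq_big_seq => w; case: ifP => // /LL' /negP.
Qed.

Lemma cyl_rep i (D : coord -> Prop) L z : uniq L -> (forall w, D w -> w \in L) ->
  cyl D z -> exists e, rep i L (fun u => (z u)%:R) e.
Proof.
move=> uL DL; elim => [w a /DL wL wa||y _ [e ye]|y y' _ [e ye] _ [e' y'e']].
- pose b w' := if w' == w then a else xpredT.
  exists (weight i L b).
  have := @rep_monomial i L b; rewrite (_ : monomial L b = fun u => (a (u w))%:R).
    by apply=> w'; rewrite /b; case: eqP => [->|_] //; exact: (meas_cst w'.1 true).
  apply/funext => u; rewrite /monomial (bigD1_seq w) //= /b eqxx big1 ?mulr1 //.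
  by move=> w' /negbTE ->.
- by exists 1; exact: rep1.
- exists (1 - e); have := rep_sub (rep1 i L) ye.
  by congr rep; apply/funext => u; case: (y u); rewrite /= ?subrr ?subr0.
- have [e'' H] := rep_mul ye y'e'; exists e''; move: H.
  by congr rep; apply/funext => u; rewrite -natrM mulnb.
Qed.

(** * The product measure *)

Definition integral i f e := exists2 L, uniq L & rep i L f e.

Lemma integral2 i f g e e' : integral i f e -> integral i g e' ->
  exists L, [/\ uniq L, rep i L f e & rep i L g e'].
Proof.
move=> [L uL fe] [L' uL' ge]; exists (undup (L ++ L')); split.
- exact: undup_uniq.
- apply: rep_widen fe; rewrite ?undup_uniq // => w wL.
  by rewrite mem_undup mem_cat wL.
- apply: rep_widen ge; rewrite ?undup_uniq // => w wL.
  by rewrite mem_undup mem_cat wL orbT.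
Qed.

Lemma integral_inj i f e e' : integral i f e -> integral i f e' -> e = e'.
Proof.
move=> fe fe'; have [L [uL Le Le']] := integral2 fe fe'.
by apply/eqP; rewrite eq_le !(rep_le uL Le Le', rep_le uL Le' Le).
Qed.

(** The default 0 is never met on cylinders: their integral exists by [cyl_rep] and is unique by
    [integral_inj]. *)
Definition prod_prob i (z : point -> bool) : R :=
  xget 0 (fun e => integral i (fun u => (z u)%:R) e).

Lemma prod_prob_eq i (z : point -> bool) e :
  integral i (fun u => (z u)%:R) e -> prod_prob i z = e.
Proof.
by move=> ze; apply: xget_subset1 => // x y; exact: integral_inj.
Qed.

Lemma cyl_integral i D z : cyl D z -> integral i (fun u => (z u)%:R) (prod_prob i z).
Proof.
move=> /cyl_fin[F [_ Fz]].
have [|e ze] := @cyl_rep i _ (undup F) z (undup_uniq F) _ Fz.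
  by move=> w; rewrite mem_undup.
have H : integral i (fun u => (z u)%:R) e by exists (undup F); rewrite ?undup_uniq.
by rewrite (prod_prob_eq H).
Qed.

Lemma prod_prob_gen i w a : meas w.1 a ->
  prod_prob i (fun u => a (u w)) = law w.1 i a.
Proof.
move=> wa; apply: prod_prob_eq; exists [:: w] => //.
have := @rep_monomial i [:: w] (fun w' => if w' == w then a else xpredT).
rewrite /weight big_seq1 eqxx (_ : monomial _ _ = fun u => (a (u w))%:R); last first.
  by apply/funext => u; rewrite /monomial big_seq1 eqxx.
by apply=> w'; case: eqP => [->|_] //; exact: (meas_cst w'.1 true).
Qed.

Lemma prod_prob_set_prob i D : set_prob (cyl D) (prod_prob i).
Proof.
split=> [|z /cyl_integral zP|y z yP zP].
- by apply: prod_prob_eq; exists [::] => //; exact: rep1.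
- by have [L uL /(rep_ge0 uL)] := zP i; apply=> u.
- have yzP := cyl_integral i (cylI yP zP).
  have yNzP := cyl_integral i (cylI yP (cylN zP)).
  have [L [uL H H']] := integral2 yzP yNzP.
  apply: prod_prob_eq; exists L => //; have := rep_add H H'.
  by congr rep; apply/funext => u; case: (y u) (z u) => -[] /=;
    rewrite ?addr0 ?add0r.
Qed.

End ProductMeasure.

(** * The Hilbert hotel: a nonempty cylinder blown up to the whole product *)

Section Hotel.
Variables (R : realType) (I H : Type) (h0 : H).
Local Open Scope ring_scope.
(** Sequences, so that finitely many points of [V] fit into a single one. *)
Let V := nat -> H.
Let v0 : V := fun=> h0.
Local Notation space := (space R I V).
Local Notation coord := (coord R I V).
Local Notation point := (point R I V).
Local Notation cylinder := (@cylinder R I V).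

(* The hotel: [sh] and [ush] identify the coordinates other than [(c, 0)] with
   those outside [F'], without changing their space. *)
Lemma coord_shift (F : seq coord) : exists2 F' : seq coord,
  uniq F' /\ {subset F <= F'} &
  forall c : space, exists sh ush : coord -> coord,
    [/\ forall w, (sh w).1 = w.1, forall w, (ush w).1 = w.1,
        forall w, w != (c, 0%N) -> sh w \notin F' /\ ush (sh w) = w &
        forall w, w \notin F' -> ush w != (c, 0%N) /\ sh (ush w) = w].
Proof.
(* [F'] is the full block of the first [N] copies of every space that occurs in [F]. *)
pose C := undup (map fst F); pose N := (\max_(w <- F) w.2.+1)%N.
have inF' (w : coord) : (w \in [seq (c, k) | c <- C, k <- iota 0 N]) =
    (w.1 \in C) && (w.2 < N)%N.
  apply/allpairsP/andP => [[[c k] /= [cC]]|[wC wN]].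
    by rewrite mem_iota => kN ->.
  by exists w; rewrite mem_iota -surjective_pairing.
exists [seq (c, k) | c <- C, k <- iota 0 N].
  split=> [|w wF].
    by apply: allpairs_uniq; rewrite ?undup_uniq ?iota_uniq // => -[? ?] [? ?].
  rewrite inF' mem_undup map_f //= /N.
  by rewrite (big_rem w wF) /= leq_max ltnSn.
(* [d] counts the copies of a space inside [F']. [sh] closes the gap at [(c, 0)] and then jumps over
   these copies. The truncated subtractions lose information only at [(c, 0)] for [sh] and inside
   [F'] for [ush], the coordinates left out. *)
move=> c; pose d (c' : space) := if c' \in C then N else 0%N.
exists (fun w => (w.1, (w.2 - (w.1 == c) + d w.1)%N)),
  (fun w => (w.1, (w.2 - d w.1 + (w.1 == c))%N)).
split=> // [[c' k]|[c' k]]; rewrite inF' /= /d.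
- move=> wc; split.
    by case: ifP => //= _; rewrite ltnNge leq_addl.
  congr pair; rewrite addnK subnK //.
  by case: (c' =P c) wc => // ->; case: k => [|k]; rewrite ?eqxx ?leq0n.
- move=> kN; split; first by apply/eqP => -[->]; rewrite eqxx addn1.
  congr pair; rewrite addnK subnK //; move: kN; case: ifP => //= _.
  by rewrite -leqNgt.
Qed.

(** * Packing the coordinates of [F] into one conditional space *)

Section Pack.
Variables (F : seq coord) (x : point -> bool) (u0 : point).
Hypotheses (uF : uniq F) (Fx : cyl (fun w => w \in F) x) (xu0 : x u0).

(** Entry [l] of the value at the [j]-th coordinate of [F] is stored at the code of [(j, l)]. *)
Definition enc (u : point) : V := fun p =>
  if unpickle p is Some (j, l) then nth v0 (map u F) j l else h0.

Definition dec (v : V) : point := fun w =>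
  if w \in F then fun l => v (pickle (index w F, l)) else v0.

Lemma dec_enc u w : w \in F -> dec (enc u) w = u w.
Proof.
move=> wF; apply/funext => l; rewrite /dec wF /enc pickleK.
by rewrite (nth_map w) ?index_mem // nth_index.
Qed.

Lemma dec_encK v : dec (enc (dec v)) = dec v.
Proof.
apply/funext => w; case: (boolP (w \in F)) => [/dec_enc->//|/negbTE wF].
by rewrite /dec wF.
Qed.

Lemma cyl_dec_enc u : x (dec (enc u)) = x u.
Proof. by apply: cyl_eq Fx => w a wF _; rewrite dec_enc. Qed.

(* A retraction onto the packed points of [x], so that codes of points outside
   [x] need not be excluded from [V]. *)
Definition pack (v : V) : point :=
  if x (dec v) then dec v else dec (enc u0).

Lemma pack_in v : x (pack v).
Proof. by rewrite /pack; case: ifP => // _; rewrite cyl_dec_enc. Qed.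

Lemma pack_enc u : x u -> pack (enc u) = dec (enc u).
Proof. by rewrite /pack cyl_dec_enc => ->. Qed.

Lemma dec_enc_pack v : dec (enc (pack v)) = pack v.
Proof. by rewrite /pack; case: ifP; rewrite dec_encK. Qed.

(** Pulling cylinders back along [pack] makes every coordinate of [pack v] measurable; by [cyl_enc],
    such sets read through [enc] consult only [F]. *)
Definition pack_meas (a : V -> bool) :=
  exists2 b, cylinder b & a = fun v => b (pack v).

Lemma pack_meas_algebra : set_algebra pack_meas.
Proof.
split.
- by exists xpredT => //; exact: cylT.
- by move=> _ [b Bb ->]; exists (fun u => ~~ b u) => //; exact: cylN.
- move=> _ _ [b Bb ->] [b' Bb' ->].
  by exists (fun u => b u && b' u) => //; exact: cylI.
Qed.

(** On [x] the retraction leaves the decoded point alone, and off [x] it is constant, so the set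
    splits along [x]. *)
Lemma cyl_enc a : pack_meas a -> cyl (fun w => w \in F) (fun u => a (enc u)).
Proof.
move=> [b Bb ->].
rewrite (_ : (fun u => b _) =
    fun u => (x u && b (dec (enc u))) || (~~ x u && b (dec (enc u0)))); last first.
  by apply/funext => u; rewrite /pack cyl_dec_enc; case: ifP; rewrite ?orbF.
apply: cylU; apply: cylI => //; last exact: cyl_cst; last exact: cylN.
apply: (cyl_subst (f := fun u => dec (enc u))) Bb => w a' _ wa'.
case: (boolP (w \in F)) => [wF|/negbTE wF].
  rewrite (_ : (fun u => _) = fun u => a' (u w)); first exact: cyl_gen.
  by apply/funext => u; rewrite dec_enc.
(* Outside [F] the decoded point has the constant value [v0]. *)
rewrite (_ : (fun u => _) = fun=> a' v0); first exact: cyl_cst.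
by apply/funext => u; rewrite /dec wF.
Qed.

Lemma cyl_enc_in a : pack_meas a ->
  cyl (fun w => w \in F) (fun u => x u && a (enc u)).
Proof. by move=> /cyl_enc; exact: cylI. Qed.

(* The conditional law given [x]; any law on [x] does when [x] is null. *)
Definition pack_law i (a : V -> bool) : R :=
  if prod_prob i x == 0 then (a (enc u0))%:R
  else prod_prob i (fun u => x u && a (enc u)) / prod_prob i x.

Lemma pack_law_prob i : set_prob pack_meas (pack_law i).
Proof.
have [_ P0 PD] := prod_prob_set_prob v0 i (fun w => w \in F).
rewrite /pack_law; split.
- case: eqP => // /eqP p0; rewrite -[RHS](divff p0); congr (prod_prob _ _ / _).
  by apply/funext => u; rewrite andbT.
- move=> a ma; case: eqP => _; first exact: ler0n.
  by rewrite divr_ge0 ?P0 //; exact: cyl_enc_in.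
- move=> a b ma mb; case: eqP => _.
    by case: (a _) (b _) => -[]; rewrite /= ?addr0 ?add0r.
  rewrite -mulrDl (PD _ _ (cyl_enc_in ma) (cyl_enc mb)).
  by congr (_ / _); congr (_ + _); congr prod_prob; apply/funext => u; rewrite andbA.
Qed.

Definition pack_space : space := Space pack_meas_algebra pack_law_prob.

(** If [x] is null, both sides vanish by monotonicity; otherwise this is the definition of the
    conditional law. *)
Lemma pack_lawE i a : pack_meas a ->
  prod_prob i (fun u => x u && a (enc u)) = prod_prob i x * pack_law i a.
Proof.
move=> ma; rewrite /pack_law; case: eqP => [p0|/eqP p0]; last by rewrite mulrC divfK.
rewrite p0 mul0r; apply: le_anti.
have [_ P0 _] := prod_prob_set_prob v0 i (fun w => w \in F).
rewrite P0 ?andbT; last exact: cyl_enc_in.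
rewrite -p0; apply: (set_prob_le (cyl_algebra _) (prod_prob_set_prob v0 i _)).
- exact: cyl_enc_in.
- exact: Fx.
- by move=> u /andP[].
Qed.

Let w0 : coord := (pack_space, 0%N).

Variables (sh ush : coord -> coord).
Hypotheses (sh1 : forall w, (sh w).1 = w.1) (ush1 : forall w, (ush w).1 = w.1)
  (shK : forall w, w != w0 -> sh w \notin F /\ ush (sh w) = w)
  (ushK : forall w, w \notin F -> ush w != w0 /\ sh (ush w) = w).

(** The new coordinate [w0] receives the packed block [F]. Restricted to [x], [blow] is inverse to
    [shrink] up to what cylinders can separate. *)
Definition blow (u : point) : point := fun w => if w == w0 then enc u else u (sh w).

Definition shrink (v : point) : point := fun w =>
  if w \in F then pack (v w0) w else v (ush w).

Lemma cylinder_blow z : cylinder z -> cylinder (fun u => z (blow u)).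
Proof.
apply: cyl_subst => w a _ wa; rewrite /blow; case: eqP => [ww0|_].
  by apply: cyl_sub (cyl_enc _) => //; move: wa; rewrite ww0.
by apply: cyl_gen; rewrite ?sh1.
Qed.

Lemma cylinder_shrink z : cylinder z -> cylinder (fun v => z (shrink v)).
Proof.
apply: cyl_subst => w a _ wa; rewrite /shrink; case: (w \in F).
  apply: (@cyl_gen _ _ _ _ w0 (fun v => a (pack v w))) => //=.
  by exists (fun u => a (u w)) => //; exact: cyl_gen.
by apply: cyl_gen; rewrite ?ush1.
Qed.

Lemma shrink_in v : x (shrink v).
Proof.
have -> : x (shrink v) = x (pack (v w0)); last exact: pack_in.
apply: cyl_eq Fx => w a wF _.
by rewrite /shrink wF.
Qed.

(** The two points may differ at [w0], but the measurable sets there see a value only through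
    [pack]. *)
Lemma shrinkK z v : cylinder z -> z (blow (shrink v)) = z v.
Proof.
apply: cyl_eq => w a _ wa; rewrite /blow; case: eqP wa => [->|/eqP ww0] wa.
  case: wa => b _ ->; rewrite pack_enc ?shrink_in // -(dec_enc_pack (v w0)).
  congr (b _); apply/funext => w'; case: (boolP (w' \in F)) => [w'F|/negbTE w'F].
    by rewrite !dec_enc // /shrink w'F.
  by rewrite /dec w'F.
by have [/negbTE shF shw] := shK ww0; rewrite /shrink shF shw.
Qed.

Lemma blowK u : x u -> shrink (blow u) = u.
Proof.
move=> xu; apply/funext => w; rewrite /shrink; case: ifP => [wF|/negbT wF].
  by rewrite /blow eqxx pack_enc ?dec_enc.
by have [/negbTE uw0 uw] := ushK wF; rewrite /blow uw0 uw.
Qed.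

(** By linearity it suffices to treat boxes. The side at [w0] becomes an event on the block [F],
    with mass given by [pack_lawE]; the other sides move to coordinates outside [F] and are
    independent of it. *)
Lemma prod_prob_blow i z : cylinder z ->
  prod_prob i (fun u => x u && z (blow u)) = prod_prob i x * prod_prob i z.
Proof.
move=> /(cyl_integral v0 i)[L uL zL].
(* Put [w0] at the head of the coordinates, whether or not it occurs in [L]. *)
pose L0 := [seq w <- L | w != w0].
have uL0 : uniq (w0 :: L0) by rewrite /= mem_filter eqxx filter_uniq.
have {zL} [|J [r [a [ma zE ->]]]] := rep_widen uL uL0 _ zL.
  by move=> w wL; rewrite inE mem_filter wL andbT orbN.
have shL0 w : w \in L0 -> sh w \notin F /\ ush (sh w) = w.
  by rewrite mem_filter => /andP[/shK].
have ushL0 : uniq (map sh L0).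
  rewrite map_inj_in_uniq ?filter_uniq // => w w' /shL0[_ {2}<-] /shL0[_ {2}<-].
  by move=> ->.
have Fsh w : w \in F -> w \notin map sh L0.
  by move=> wF; apply/mapP => -[w' /shL0[/negP shF _] ww']; rewrite ww' in wF.
apply: (prod_prob_eq v0); exists (F ++ map sh L0).
  rewrite cat_uniq uF ushL0 andbT; apply/hasPn => _ /mapP[w /shL0[shF _] ->].
  exact: shF.
pose f j u := (x u && a j w0 (enc u))%:R * monomial (map sh L0) (fun w => a j (ush w)) u.
have -> : (fun u => (x u && z (blow u))%:R) = fun u => \sum_j r j * f j u.
  apply/funext => u; rewrite -mulnb natrM zE mulr_sumr; apply: eq_bigr => j _.
  rewrite mulrCA; congr (_ * _); rewrite /f -mulnb natrM -mulrA; congr (_ * _).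
  rewrite /monomial big_cons big_map /blow eqxx; congr (_ * _).
  apply: eq_big_seq => w wL0; rewrite (shL0 _ wL0).2.
  by case: eqP wL0 => // ->; rewrite mem_filter eqxx.
rewrite mulr_sumr; under eq_bigr do rewrite mulrCA.
apply: rep_sum => j; rewrite /weight big_cons mulrA -pack_lawE; last exact: (ma j w0).
have -> : \prod_(w <- L0) law w.1 i (a j w) = weight i (map sh L0) (fun w => a j (ush w)).
  by rewrite /weight big_map; apply: eq_big_seq => w /shL0[_ ->]; rewrite sh1.
apply: rep_indep => //; last first.
  by apply: rep_monomial => w; have := ma j (ush w); rewrite ush1.
have ax := cyl_enc_in (ma j w0).
have [e He] := cyl_rep i uF (fun w wF => wF) ax.
by rewrite (prod_prob_eq v0 (e := e)) //; exists F.
Qed.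

End Pack.

Lemma cylinder_blowup x : cylinder x -> (exists u, x u) ->
  exists phi psi : point -> point,
    [/\ forall z, cylinder z -> cylinder (fun u => z (phi u)),
        forall z, cylinder z -> cylinder (fun v => z (psi v)),
        forall v, x (psi v) /\ forall z, cylinder z -> z (phi (psi v)) = z v,
        forall u, x u -> psi (phi u) = u &
        forall i z, cylinder z -> prod_prob i (fun u => x u && z (phi u)) =
                                  prod_prob i x * prod_prob i z].
Proof.
move=> /cyl_fin[F0 [_ F0x]] [u0 xu0].
(* The block comes first: the space whose copy 0 is singled out is built from it. *)
have [F [uF F0F] HF] := coord_shift F0.
have Fx : cyl (fun w => w \in F) x by apply: cyl_sub F0x => w /F0F.
have [sh [ush [sh1 ush1 shK ushK]]] := HF (pack_space u0 Fx).
exists (blow u0 Fx sh), (shrink u0 Fx ush); split.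
- by move=> z; exact: cylinder_blow.
- by move=> z; exact: cylinder_shrink.
- by move=> v; split=> [|z]; [exact: shrink_in | exact: shrinkK].
- by move=> u; exact: blowK.
- by move=> i z; exact: (prod_prob_blow uF sh1 ush1 shK).
Qed.

End Hotel.

(** * The conditional operator on cylinders *)

Section BayesianCylinders.
Variables (R : realType) (I H : Type) (h0 : H).
Local Open Scope ring_scope.
Local Notation point := (point R I (nat -> H)).
Local Notation cylinder := (@cylinder R I (nat -> H)).

Lemma cylinder_conditional :
  exists cond : (point -> bool) -> (point -> bool) -> point -> bool,
  [/\ forall x y, cylinder x -> cylinder y -> cylinder (cond x y),
      forall (x y z : point -> bool) u, cond x (fun u => ~~ y u) u = ~~ cond x y u /\
        cond x (fun u => y u && z u) u = cond x y u && cond x z u,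
      forall (x y : point -> bool), cylinder x -> (forall u, x u -> y u) -> (exists u, x u) ->
        forall u, cond x y u,
      forall x y u, cylinder x -> cylinder y ->
        [/\ x u && cond x y u = x u && y u, cond x (cond x y) u = cond x y u &
            cond (fun u => ~~ x u) (cond x y) u = cond x y u] &
      forall i x y, cylinder x -> cylinder y ->
        prod_prob i (fun u => x u && y u) =
        prod_prob i (cond x y) * prod_prob i x].
Proof.
(* One pair of maps is chosen for each set, so that conditioning on [x] and on its complement uses
   the same two pairs. *)
have /choice[f fP] (x : point -> bool) : exists f : (point -> point) * (point -> point),
    cylinder x -> (exists u, x u) ->
    [/\ forall z, cylinder z -> cylinder (fun u => z (f.1 u)),
        forall z, cylinder z -> cylinder (fun v => z (f.2 v)),
        forall v, x (f.2 v) /\ forall z, cylinder z -> z (f.1 (f.2 v)) = z v,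
        forall u, x u -> f.2 (f.1 u) = u &
        forall i z, cylinder z -> prod_prob i (fun u => x u && z (f.1 u)) =
                                  prod_prob i x * prod_prob i z].
  have [[Bx x1]|nx] := pselect (cylinder x /\ exists u, x u).
    by have [phi [psi H']] := cylinder_blowup h0 Bx x1; exists (phi, psi).
  by exists (id, id) => Bx x1; case: nx.
pose neg (x : point -> bool) u := ~~ x u.
have negK x : neg (neg x) = x by apply/funext => u; rewrite /neg negbK.
(* If [x] is empty or everything, there is nothing to swap and [cond x] is the identity. *)
pose nt (x : point -> bool) := `[< (exists u, x u) /\ exists u, neg x u >].
have ntN x : nt (neg x) = nt x.
  by apply/asbool_equiv_eq; rewrite negK; split=> -[].
(* Off [x], the point is carried from the complement onto the whole product and from there into
   [x]. *)
pose cond (x y : point -> bool) u : bool :=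
  if ~~ nt x || x u then y u else y ((f x).2 ((f (neg x)).1 u)).
have condT (x y : point -> bool) u : x u -> cond x y u = y u.
  by rewrite /cond => ->; rewrite orbT.
have cond_nt x y : ~~ nt x -> cond x y = y.
  by move=> ntx; apply/funext => u; rewrite /cond ntx.
have condF x y u : nt x -> neg x u -> cond x y u = y ((f x).2 ((f (neg x)).1 u)).
  by rewrite /cond /neg => -> /negbTE ->.
have f1P x (Bx : cylinder x) (ntx : nt x) := fP x Bx (asboolW ntx).1.
have f2P x (Bx : cylinder x) (ntx : nt x) := fP (neg x) (cylN Bx) (asboolW ntx).2.
have condE x y : nt x -> cond x y =
    fun u => (x u && y u) || (neg x u && y ((f x).2 ((f (neg x)).1 u))).
  move=> ntx; apply/funext => u; rewrite /cond ntx /neg.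
  by case: (x u); rewrite ?orbF.
exists cond; split.
- move=> x y Bx By; have [ntx|/cond_nt-> //] := boolP (nt x).
  have [_ f12 _ _ _] := f1P x Bx ntx; have [f21 _ _ _ _] := f2P x Bx ntx.
  rewrite condE //; apply: cylU; first exact: cylI.
  apply: cylI; first exact: cylN.
  exact: (f21 _ (f12 _ By)).
- by move=> x y z u; rewrite /cond; case: ifP.
- move=> x y Bx xy x1 u; case: (boolP (x u)) => [xu|nxu].
    by rewrite condT ?xy.
  have ntx : nt x by apply/asboolP; split => //; exists u.
  have [_ _ xf2 _ _] := f1P x Bx ntx.
  by rewrite condF // xy //; case: (xf2 ((f (neg x)).1 u)).
- move=> x y u Bx By; have [ntx|ntx] := boolP (nt x); last first.
    by rewrite !cond_nt // ?ntN.
  have [_ f12 xf2 f1K _] := f1P x Bx ntx.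
  have [_ _ nxf2 _ _] := f2P x Bx ntx.
  have condI : cond x (cond x y) u = cond x y u.
    case: (boolP (x u)) => [/condT-> //|nxu].
    by rewrite [LHS]condF // condT ?condF //; case: (xf2 ((f (neg x)).1 u)).
  split=> //; first by case: (boolP (x u)) => // /condT ->.
  case: (boolP (x u)) => [xu|nxu]; last by rewrite condT.
  rewrite -/(neg x) [LHS]condF ?ntN ?negK // condF //; last by case: (nxf2 ((f x).1 u)).
  (* Going through the complement and back cancels only when tested on a cylinder, here [y] pulled
     back along [(f x).2]. *)
  have [_ nxz] := nxf2 ((f x).1 u).
  by rewrite (nxz (fun v => y ((f x).2 v))) ?f1K ?condT //; exact: f12.
- move=> i x y Bx By; 
  have PP := @prod_prob_set_prob R I (nat -> H) (fun=> h0) i (fun=> True).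
  have [P1 _ PD] := PP.
  have [ntx|ntx] := boolP (nt x); last first.
    rewrite cond_nt //; case: (pselect (exists u, x u)) => [x1|x0].
      have -> : x = xpredT.
        apply/funext => u; apply: contraNT ntx => xu; apply/asboolP.
        by split=> //; exists u.
      by rewrite P1 mulr1.
    have x0' u : x u = false by apply/negP => xu; apply: x0; exists u.
    have -> : x = xpred0 by apply/funext.
    by rewrite /= (set_prob0 (cyl_algebra _) PP) mulr0.
  have [_ f12 xf2 f1K Pf1] := f1P x Bx ntx.
  have [f21 _ nxf2 _ Pf2] := f2P x Bx ntx.
  (* [z] is the part of [y] in [x], blown up to the whole product. Both parts of [cond x y] are
     scaled copies of [z], so its measure is that of [z]. *)
  pose z v := y ((f x).2 v); have Bz : cylinder z by exact: f12.
  have -> : (fun u => x u && y u) = (fun u => x u && z ((f x).1 u)).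
    apply/funext => u; case: (boolP (x u)) => //= xu.
    by rewrite /z f1K.
  rewrite Pf1 // mulrC; congr (_ * _).
  have Bc : cylinder (cond x y).
    rewrite condE //; apply: cylU; first exact: cylI.
    by apply: cylI; [exact: cylN | exact: (f21 _ Bz)].
  rewrite (PD _ _ Bc Bx).
  have -> : (fun u => cond x y u && x u) = (fun u => x u && z ((f x).1 u)).
    apply/funext => u; rewrite andbC; case: (boolP (x u)) => //= xu.
    by rewrite condT // /z f1K.
  have -> : (fun u => cond x y u && ~~ x u) = (fun u => neg x u && z ((f (neg x)).1 u)).
    apply/funext => u; rewrite andbC; case: (boolP (x u)) => xu; rewrite /neg ?xu //=.
    by rewrite condF // /neg (negbTE xu).
  rewrite Pf1 // Pf2 // -mulrDl; have := PD _ _ (cylT (fun=> True)) Bx.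
  by rewrite P1 => <-; rewrite mul1r.
Qed.

End BayesianCylinders.

(** * A set algebra as a Boolean algebra type *)

Section SetAlgebraType.
Variable T : Type.

(** Carrying [algA] in the type lets the Boolean structure be inferred from it. *)
Definition algebra_type (A : (T -> bool) -> Prop) (algA : set_algebra A) : Type :=
  {a : T -> bool | A a}.

Variables (A : (T -> bool) -> Prop) (algA : set_algebra A).
Local Notation B := (algebra_type algA).

HB.instance Definition _ := gen_eqMixin B.
HB.instance Definition _ := gen_choiceMixin B.

Lemma algebra_ext (a b : B) : (forall t, sval a t = sval b t) -> a = b.
Proof.
case: a b => [a Aa] [b Ab] /= /funext ab.
by move: Aa Ab; rewrite ab => Aa Ab; congr exist; exact: Prop_irrelevance.
Qed.

Lemma set_algebraU a b : A a -> A b -> A (fun t => a t || b t).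
Proof.
case: algA => _ AN AI Aa Ab; have := AN _ (AI _ _ (AN _ Aa) (AN _ Ab)).
by congr A; apply/funext => t; rewrite negb_and !negbK.
Qed.

Definition algI (a b : B) : B := let: And3 _ _ AI := algA in
  exist _ _ (AI _ _ (svalP a) (svalP b)).
Definition algU (a b : B) : B := exist _ _ (set_algebraU (svalP a) (svalP b)).
Definition algN (a : B) : B := let: And3 _ AN _ := algA in exist _ _ (AN _ (svalP a)).
Definition algT : B := let: And3 AT _ _ := algA in exist _ _ AT.

Lemma algIE a b t : sval (algI a b) t = sval a t && sval b t.
Proof. by rewrite /algI; case: algA. Qed.
Lemma algNE a t : sval (algN a) t = ~~ sval a t.
Proof. by rewrite /algN; case: algA. Qed.
Lemma algTE t : sval algT t.
Proof. by rewrite /algT; case: algA. Qed.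
Lemma algUE a b t : sval (algU a b) t = sval a t || sval b t.
Proof. by []. Qed.

Definition alg_le (a b : B) := algI a b == a.
Definition alg_lt (a b : B) := (b != a) && alg_le a b.

Fact alg_le_def a b : alg_le a b = (algI a b == a). Proof. by []. Qed.
Fact alg_lt_def a b : alg_lt a b = (b != a) && alg_le a b. Proof. by []. Qed.
Fact algIC : commutative algI.
Proof. by move=> a b; apply: algebra_ext => t; rewrite !algIE andbC. Qed.
Fact algUC : commutative algU.
Proof. by move=> a b; apply: algebra_ext => t; rewrite !algUE orbC. Qed.
Fact algIA : associative algI.
Proof. by move=> a b c; apply: algebra_ext => t; rewrite !algIE andbA. Qed.
Fact algUA : associative algU.
Proof. by move=> a b c; apply: algebra_ext => t; rewrite !algUE orbA. Qed.
Fact algUKI b a : algI a (algU a b) = a.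
Proof. by apply: algebra_ext => t; rewrite algIE algUE; case: (sval a t). Qed.
Fact algIKU b a : algU a (algI a b) = a.
Proof. by apply: algebra_ext => t; rewrite algUE algIE; case: (sval a t). Qed.
Fact algIUl : left_distributive algI algU.
Proof. by move=> a b c; apply: algebra_ext => t; rewrite algUE !algIE algUE andb_orl. Qed.
Fact algII : idempotent_op algI.
Proof. by move=> a; apply: algebra_ext => t; rewrite algIE andbb. Qed.

HB.instance Definition _ := Order.isMeetJoinDistrLattice.Build (Order.Disp tt tt) B
  alg_le_def alg_lt_def algIC algUC algIA algUA algUKI algIKU algIUl algII.

Fact alg_le0 (a : B) : algN algT <= a.
Proof.
by apply/eqP/algebra_ext => t; rewrite algIE algNE algTE.
Qed.
Fact alg_le1 (a : B) : a <= algT.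
Proof. by apply/eqP/algebra_ext => t; rewrite algIE algTE andbT. Qed.

HB.instance Definition _ := Order.hasBottom.Build (Order.Disp tt tt) B alg_le0.
HB.instance Definition _ := Order.hasTop.Build (Order.Disp tt tt) B alg_le1.

Fact algUN (a : B) : a `|` algN a = \top.
Proof. by apply: algebra_ext => t; rewrite algUE algNE algTE orbN. Qed.
Fact algIN (a : B) : a `&` algN a = \bot.
Proof. by apply: algebra_ext => t; rewrite algIE !algNE algTE andbN. Qed.

HB.instance Definition _ := Order.TBDistrLattice_hasComplement.Build
  (Order.Disp tt tt) B algUN algIN.

End SetAlgebraType.

(** * Points of the Stone space *)

Section Stone.
Variables (d : Order.disp_t) (B : ctbDistrLatticeType d).

Definition two_valued (h : B -> bool) : Prop :=
  (forall x, h (~` x) = ~~ h x) /\ (forall x y, h (x `&` y) = h x && h y).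

(** The ultrafilter theorem: by Zorn's lemma there is a maximal family whose finite meets all meet
    [b], and [h] is membership in it. *)
Lemma stone (b : B) : b != \bot -> exists2 h, two_valued h & h b.
Proof.
move=> b0; pose fip (F : set B) := forall s : seq B, (forall x, x \in s -> F x) ->
  b `&` \meet_(x <- s) x != \bot.
have [|F [Ffip Fmax]] := @Zorn_bigcup B fip.
  move=> C Cfip Ctot s sC.
  (* A finite part of the union of a chain lies in one member; the empty part is separate since the
     chain may be empty. *)
  have [->|[X CX sX]] : s = [::] \/ exists2 X, C X & forall x, x \in s -> X x.
  - elim: s sC => [|x s IH] sC; first by left.
    have [X CX Xx] := sC x (mem_head _ _); right.
    have [|->|[Y CY sY]] := IH.
    + by move=> y ys; apply: sC; rewrite inE ys orbT.
    + by exists X => // y; rewrite inE => /eqP ->.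
    + have [XY|YX] := Ctot _ _ CX CY.
        by exists Y => // y; rewrite inE => /predU1P[->|/sY//]; exact: XY.
      by exists X => // y; rewrite inE => /predU1P[->//|/sY]; exact: YX.
  - by rewrite big_nil meetx1.
  - exact: Cfip CX _ sX.
have Fbot s : b `&` \meet_(x <- s) x = \bot -> ~ forall x, x \in s -> F x.
  by move=> s0 /Ffip; rewrite s0 eqxx.
have FN x : F x \/ F (~` x).
  apply: contrapT => /not_orP[nFx nFNx].
  (* By maximality, adding [y] breaks the finite meet property; [y] itself is then split off from
     the offending list. *)
  have ext y : ~ F y -> exists s : seq B, (forall z, z \in s -> F z) /\
      b `&` (y `&` \meet_(z <- s) z) = \bot.
    move=> nFy; have /existsNP[s /not_implyP[sF /negP]] :
        ~ fip (fun z => z = y \/ F z).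
      apply: Fmax; split; first by move=> z Fz; right.
      by move=> /(_ y) H; apply/nFy/H; left.
    rewrite negbK => /eqP s0; exists [seq z <- s | z != y]; split.
      by move=> z; rewrite mem_filter => /andP[/eqP zy /sF[]].
    apply/eqP; rewrite -lex0 -s0; apply: leI2 => //; apply/meetsP_seq => z zs _.
    have [->|zy] := eqVneq z y; first exact: leIl.
    by rewrite leIxr // meets_inf_seq // mem_filter zy.
  have [s [sF s0]] := ext _ nFx; have [s' [s'F s'0]] := ext _ nFNx.
  apply: (Fbot (s ++ s')); last by move=> z; rewrite mem_cat => /orP[/sF|/s'F].
  rewrite big_cat /=; move: (\meet_(z <- s) z) (\meet_(z <- s') z) s0 s'0.
  (* Split along [x] and its complement: each half lies below a meet known to be bottom. *)
  move=> m m' s0 s'0; rewrite -[LHS]meetx1 -(joinxC x) meetUr; apply/eqP.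
  rewrite -lex0 leUx; apply/andP; split; [rewrite -s0 | rewrite -s'0];
    rewrite !lexI; apply/and3P; split; rewrite ?leIr //; apply: leIxl;
    rewrite ?leIl //; apply: leIxr; rewrite ?leIl ?leIr //.
have FC x : F x -> F (~` x) -> False.
  move=> Fx FNx; apply: (Fbot [:: x; ~` x]).
    by rewrite !big_cons big_nil meetx1 meetxC meetx0.
  by move=> y; rewrite !inE => /orP[]/eqP->.
have Fup x y : F x -> x <= y -> F y.
  move=> Fx xy; have [//|FNy] := FN y; exfalso; apply: (Fbot [:: x; ~` y]).
    rewrite !big_cons big_nil meetx1; apply/eqP; rewrite -lex0 leIxr //.
    by rewrite -(meetxC y) leI2.
  by move=> z; rewrite !inE => /orP[]/eqP->.
exists (fun x => `[< F x >]); last first.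
  apply/asboolP; have [//|FNb] := FN b; exfalso; apply: (Fbot [:: ~` b]).
    by rewrite big_seq1 meetxC.
  by move=> z; rewrite inE => /eqP->.
split=> [x|x y].
  rewrite -asbool_neg; apply: asbool_equiv_eq; split=> [FNx Fx|nFx]; first exact: FC FNx.
  by case: (FN x).
rewrite -asbool_and; apply: asbool_equiv_eq; split=> [Fxy|[Fx Fy]].
  by split; apply: Fup Fxy _; rewrite ?leIl ?leIr.
have [//|FNxy] := FN (x `&` y); exfalso; apply: (Fbot [:: x; y; ~` (x `&` y)]).
  by rewrite !big_cons big_nil meetx1 (meetA x) meetxC meetx0.
by move=> z; rewrite !inE => /or3P[]/eqP->.
Qed.
End Stone.

(** * The given algebra as one of the spaces *)

Section BaseSpace.
Variables (R : realType) (d : Order.disp_t) (B : ctbDistrLatticeType d).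
Variables (h0 : B -> bool) (h0P : two_valued h0).
Local Open Scope ring_scope.
Local Notation V := (nat -> B -> bool).

(* [V] also contains functions that are not points of the Stone space; they are
   all sent to [h0]. *)
Definition stone_set (b : B) (v : V) : bool :=
  if `[< two_valued (v 0%N) >] then v 0%N b else h0 b.

Lemma stone_set_two_valued v : two_valued (stone_set^~ v).
Proof. by rewrite /stone_set; case: asboolP. Qed.

Lemma stone_setN b : stone_set (~` b)%O = fun v => ~~ stone_set b v.
Proof. by apply/funext => v; case: (stone_set_two_valued v). Qed.

Lemma stone_setI b b' : stone_set (b `&` b')%O = fun v => stone_set b v && stone_set b' v.
Proof. by apply/funext => v; case: (stone_set_two_valued v). Qed.

Lemma stone_set1 : stone_set \top%O = xpredT.
Proof.
rewrite -[(\top)%O]complK compl1 -(meetxC (\top : B)) stone_setN stone_setI stone_setN.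
by apply/funext => v; rewrite andbN.
Qed.

(** If [b] is not below [b'], a Stone point in [b] but not in [b'] separates their sets. *)
Lemma stone_set_inj : injective stone_set.
Proof.
suff le b b' : stone_set b = stone_set b' -> (b <= b')%O.
  by move=> b b' bb'; apply: le_anti; rewrite !le.
move=> bb'; have [|/stone[h hP]] := eqVneq (b `&` ~` b')%O (\bot)%O.
  by move=> H; rewrite leEmeet -[X in _ == X]meetx1 -(joinxC b') meetUr H joinx0.
have hE c : stone_set c (fun=> h) = h c by rewrite /stone_set; case: asboolP.
by case: hP => hN hI; rewrite hI hN -!hE bb' andbN.
Qed.

Definition stone_meas (a : V -> bool) := exists b, a = stone_set b.

Lemma stone_meas_algebra : set_algebra stone_meas.
Proof.
split; first by exists (\top)%O; rewrite stone_set1.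
  by move=> _ [b ->]; exists (~` b)%O; rewrite stone_setN.
by move=> _ _ [b ->] [b' ->]; exists (b `&` b')%O; rewrite stone_setI.
Qed.

(** All distributions serve as indices, so the algebra built does not depend on any one of them. *)
Let I := {P : B -> R | probability_distribution P}.

Definition stone_law (i : I) (a : V -> bool) : R :=
  sval i (xget (\bot)%O (fun b => a = stone_set b)).

Lemma stone_lawE i b : stone_law i (stone_set b) = sval i b.
Proof.
congr (sval i _); apply: xget_subset1 => // x y -> ; exact: stone_set_inj.
Qed.

Lemma stone_law_prob i : set_prob stone_meas (stone_law i).
Proof.
case: (svalP i) => P0 P00 P1 PD; split=> [|_ [b ->]|_ _ [b ->] [b' ->]].
- by rewrite -stone_set1 stone_lawE.
- by rewrite stone_lawE.
- have E : stone_set (b `&` ~` b')%O = fun v => stone_set b v && ~~ stone_set b' v.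
    by rewrite stone_setI stone_setN.
  rewrite -E -stone_setI !stone_lawE -PD -meetUr joinxC meetx1.
  by rewrite meetACA meetxC meetx0 P00 add0r.
Qed.

Definition stone_space : space R I V := Space stone_meas_algebra stone_law_prob.

End BaseSpace.

(** * Assembling the Bayesian algebra *)

Lemma set_prob_distribution (R : realType) (T : Type) (A : (T -> bool) -> Prop)
    (algA : set_algebra A) (Q : (T -> bool) -> R) :
  set_prob A Q -> probability_distribution (fun a : algebra_type algA => Q (sval a)).
Proof.
move=> QP; have [QT Q0 QD] := QP; split.
- by move=> a; apply/Q0/svalP.
- rewrite -[RHS](set_prob0 algA QP); congr Q; apply/funext => t.
  by rewrite algNE algTE.
- by rewrite -[RHS]QT; congr Q; apply/funext => t; rewrite algTE.
(* Split both [a] and the join along [b]: outside [b] they coincide. *)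
- move=> a b; rewrite (QD (sval a) (sval b)) ?(QD (sval (a `|` b)) (sval b));
    [|exact: svalP..].
  have -> : (fun t => sval (a `|` b) t && sval b t) = sval b.
    by apply/funext => t; rewrite algUE; case: (sval b t); rewrite ?orbT ?andbF.
  have -> : (fun t => sval (a `|` b) t && ~~ sval b t) =
            (fun t => sval a t && ~~ sval b t).
    by apply/funext => t; rewrite algUE; case: (sval b t); rewrite ?andbF ?orbF.
  rewrite [LHS]addrCA [LHS]addrC.
  congr (_ + _ + _)%R; congr Q; apply/funext => t; exact: algIE.
Qed.

Theorem theorem1 (R : realType) (d : Order.disp_t)
    (Boole : ctbDistrLatticeType d) :
  exists (d' : Order.disp_t) (Bayes : ctbDistrLatticeType d')
         (cond : Bayes -> Bayes -> Bayes) (delta : Boole -> Bayes),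
    [/\ injective delta /\ boolean_morphism delta,
        forall x y : Bayes,
          [/\ boolean_endomorphism (fun z : Bayes => cond x z),
              x <= y -> cond x y = \top \/ x = \bot,
              x `&` cond x y = x `&` y,
              cond (~` x) (cond x y) = cond x (cond x y) &
              cond x (cond x y) = cond x y] &
        forall Poole : Boole -> R, probability_distribution Poole ->
          exists Payes : Bayes -> R,
            [/\ probability_distribution Payes,
                forall x : Boole, Payes (delta x) = Poole x &
                forall x y : Bayes,
                  Payes (x `&` y) = (Payes (cond x y) * Payes x)%R]].
Proof.
(* The one-element algebra has no Stone point to start from, but it carries no probability
   distribution either. *)
have [triv|nontriv] := eqVneq (\top : Boole) \bot.
  have eqB (x y : Boole) : x = y.
    by rewrite -(meetx1 x) -(meetx1 y) triv !meetx0.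
  exists d, Boole, (fun _ y => y), id; split=> [|x y|P [_ P0 P1 _]].
  - by split; [exact: inj_id | split].
  - by split=> //; right; exact: eqB.
  - by move: (oner_neq0 R); rewrite -P1 triv P0 eqxx.
have [h0 h0P _] := stone nontriv.
pose I := {P : Boole -> R | probability_distribution P}.
have [cond [condB condM condT condX condP]] := @cylinder_conditional R I (Boole -> bool) h0.
pose algC := @cyl_algebra R I (nat -> Boole -> bool) (fun=> True).
pose Bayes := algebra_type algC.
pose c (x y : Bayes) : Bayes := exist _ _ (condB _ _ (svalP x) (svalP y)).
(* The given algebra is embedded through copy 0 of its Stone space. *)
pose w0 : coord R I (nat -> Boole -> bool) := (stone_space R h0P, 0%N).
have deltaB b : cylinder (fun u => stone_set h0 b (u w0)).
  by apply: cyl_gen => //; exists b.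
pose delta b : Bayes := exist _ _ (deltaB b).
have svalI (x y : Bayes) : sval (x `&` y) = fun u => sval x u && sval y u.
  by apply/funext => u; exact: algIE.
have svalN (x : Bayes) : sval (~` x) = fun u => ~~ sval x u.
  by apply/funext => u; exact: algNE.
exists (Order.Disp tt tt), Bayes, c, delta; split=> [|x y|P PP].
- split=> [b b' /(congr1 sval) /= bb'|].
    apply: (@stone_set_inj _ _ h0); apply/funext => v.
    (* Constant points recover a set from the cylinder above it. *)
    exact: (congr1 (@^~ (fun=> v)) bb').
  split=> [b|b b']; apply: algebra_ext => u; rewrite ?svalN ?svalI /=.
    by rewrite stone_setN.
  by rewrite stone_setI.
- have [condI condcond condN] := all_and3 (fun u => condX _ _ u (svalP x) (svalP y)).
  split.
  + split=> [z|z z']; apply: algebra_ext => u; rewrite ?svalN ?svalI /= ?svalN ?svalI.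
      by case: (condM (sval x) (sval z) (sval z) u).
    by case: (condM (sval x) (sval z) (sval z') u).
  + move=> xy; have [x1|x0] := pselect (exists u, sval x u); [left|right];
      apply: algebra_ext => u.
      rewrite algTE; apply: condT => // [|v xv]; first exact: svalP.
      by move: xv; rewrite -(meet_l xy) svalI => /andP[].
    by rewrite algNE algTE; apply/negP => xu; apply: x0; exists u.
  + by apply: algebra_ext => u; rewrite !svalI.
  + by apply: algebra_ext => u; rewrite /= svalN condN condcond.
  + by apply: algebra_ext => u; exact: condcond.
- pose i : I := exist _ P PP.
  exists (fun z => prod_prob i (sval z)); split.
  + exact/set_prob_distribution/(prod_prob_set_prob (fun _ => h0)).
  + move=> b /=; rewrite (prod_prob_gen (fun _ => h0) i (w := w0)); last by exists b.
    exact: stone_lawE.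
  + by move=> x y; rewrite svalI; apply: condP; exact: svalP.
Qed.
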